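(* Let $\mathcal M=(S,S_\Box,S_\bigcirc,\longrightarrow,P)$ be a universally transient countable MDP (possibly infinitely branching), let $T\subseteq S$, and let $\varphi=\mathtt{Safety}(T)$. For every $\varepsilon>0$ there exists a uniformly $\varepsilon$-optimal MD strategy $\sigma$ for $\varphi$, i.e. an MD strategy with $\mathcal P_{\mathcal M,s,\sigma}(\varphi)\ge\mathtt{val}_{\mathcal M,\varphi}(s)-\varepsilon$ for every $s\in S$.
   Context: MDPs: an MDP is a tuple $\mathcal M=(S,S_\Box,S_\bigcirc,\longrightarrow,P)$ where $S$ is a countable set of states partitioned into controlled states $S_\Box$ and random states $S_\bigcirc$, $\longrightarrow\subseteq S\times S$ is a transition relation in which every state has at least one (possibly infinitely many) successor, and $P$ assigns to each random state $s$ a probability distribution $P(s)$ on its successors. A run is an infinite sequence $s_0s_1\cdots$ with $s_i\longrightarrow s_{i+1}$ for all $i$. A strategy is a function $\sigma:S^*S_\Box\to\mathcal D(S)$ (where $\mathcal D(S)$ is the set of probability distributions on $S$) assigning to each finite sequence $\rho s$ ending in a controlled state $s$ a distribution over successors of $s$. A strategy $\sigma$ and initial state $s_0$ induce the usual probability measure $\mathcal P_{\mathcal M,s_0,\sigma}$ on infinite sequences starting in $s_0$ (at random states the successor is drawn according to $P$). A strategy is memoryless deterministic (MD) if it is given by a function $\sigma:S_\Box\to S$ choosing a successor of each controlled state. For a measurable objective $\varphi$ (a set of runs), $\mathtt{val}_{\mathcal M,\varphi}(s)=\sup_\sigma \mathcal P_{\mathcal M,s,\sigma}(\varphi)$, the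 supremum over all strategies. $\mathtt{Safety}(T)$ is the set of runs that never visit $T$. $\mathtt{Transience}$ is the set of runs that visit no state infinitely often. $\mathcal M$ is universally transient if $\mathcal P_{\mathcal M,s_0,\sigma}(\mathtt{Transience})=1$ for all states $s_0$ and all strategies $\sigma$. *)

(* Defs.v *)
From HB Require Import structures.
From mathcomp Require Import all_boot all_order all_algebra.
From mathcomp Require Import all_classical all_reals all_analysis.
From mathcomp Require Import ring lra.

Set Implicit Arguments.
Unset Strict Implicit.
Unset Printing Implicit Defensive.

Import Order.TTheory GRing.Theory Num.Theory.
Import numFieldNormedType.Exports.

Local Open Scope classical_set_scope.
Local Open Scope ring_scope.

Record dist (R : realType) (S : countType) := Dist {
  pmf :> S -> R;
  pmf_ge0 : forall s, 0 <= pmf s;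
  pmf_sum1 : \esum_(s in [set: S]) (pmf s)%:E = 1%E }.

(* The random states are those outside [ctrl]; the value of [prob] at a
   controlled state is never used. *)
Record mdp (R : realType) (S : countType) := MDP {
  ctrl : pred S;
  trans : S -> S -> Prop;
  prob : S -> dist R S;
  trans_total : forall s, exists t, trans s t;
  prob_trans : forall s t, ~~ ctrl s -> 0 < prob s t -> trans s t }.

(* [sigma rho s] is the distribution used after the history [rho ++ [:: s]];
   its value at a random state [s] is never used. *)
Record strategy (R : realType) (S : countType) (M : mdp R S) := Strategy {
  decision :> seq S -> S -> dist R S;
  decision_trans : forall rho s t,
    ctrl M s -> 0 < decision rho s t -> trans M s t }.

(* [f s] is a successor of [s] by [decision_trans]. *)
Definition MD (R : realType) (S : countType) (M : mdp R S)
    (sigma : strategy M) :=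
  exists f : S -> S, forall rho s t, ctrl M s -> sigma rho s t = (t == f s)%:R.

Definition step (R : realType) (S : countType) (M : mdp R S)
    (sigma : strategy M) (rho : seq S) (s : S) : dist R S :=
  if ctrl M s then sigma rho s else prob M s.

(* The initial state is a parameter only because a measurableType must be
   pointed; the sigma-algebra does not depend on it. *)
Definition seqs (S : countType) (s0 : S) : Type := nat -> S.

HB.instance Definition _ (S : countType) (s0 : S) :=
  Choice.copy (seqs s0) (nat -> S).
HB.instance Definition _ (S : countType) (s0 : S) :=
  isPointed.Build (seqs s0) (fun=> s0).

Definition cylinder (S : Type) (g : nat -> S) (n : nat) : set (nat -> S) :=
  [set f | forall i, (i < n)%N -> f i = g i].

Definition cylinders (S : countType) (s0 : S) : set (set (seqs s0)) :=
  [set A | exists g n, A = cylinder g n].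
Arguments cylinders {S} s0.

Notation seqSpace s0 := (g_sigma_algebraType (cylinders s0)).

(* The state [g i] is visited after the history [mkseq g i], i.e.
   [g 0, ..., g (i - 1)]. *)
Definition is_run_law (R : realType) (S : countType) (M : mdp R S) (s0 : S)
    (sigma : strategy M) (P : probability (seqSpace s0) R) :=
  forall (g : nat -> S) n, g 0%N = s0 ->
    P (cylinder g n.+1) =
    (\prod_(i < n) step sigma (mkseq g i) (g i) (g i.+1))%:E.

Lemma mkseq_eqP (S : eqType) (f g : nat -> S) n :
  (forall i, (i < n)%N -> f i = g i) <-> mkseq f n = mkseq g n.
Proof.
split=> [fg|fg i ni].
  by rewrite /mkseq; apply/eq_in_map => i; rewrite mem_iota => /fg.
by rewrite -(nth_mkseq (f i) f ni) fg nth_mkseq.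
Qed.

(* A process with prescribed conditional laws [q h] given its past [h] is
   realised on [0, 1[ with Lebesgue measure: each cylinder corresponds to a
   subinterval, split among the next states in the order of the enumeration
   [pickle]. *)
Section realisation.
Variables (R : realType) (S : countType) (s0 : S) (q : seq S -> dist R S).

Let a h (i : nat) : R := oapp (q h) 0 (pickle_inv i : option S).
Let c h n : R := \sum_(i < n) a h i.
Let cum h (t : S) : R := c h (pickle t).

Let a_ge0 h i : 0 <= a h i.
Proof. by rewrite /a; case: pickle_inv => //= t; exact: pmf_ge0. Qed.

Let a_pickle h t : a h (pickle t) = q h t.
Proof. by rewrite /a pickleK_inv. Qed.

Let a_sum h : (\sum_(i <oo) (a h i)%:E = 1)%E.
Proof.
rewrite nneseries_esumT; last by move=> n; rewrite lee_fin.
rewrite -(pmf_sum1 (q h)).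
transitivity (\esum_(i in pickle @` [set: S]) (a h i)%:E)%E.
  rewrite [RHS]esum_mkcond; apply: eq_esum => i _.
  case: ifPn => // /negP ni.
  rewrite /a; case E: (pickle_inv i : option S) => [t|] //=; exfalso; apply: ni.
  by rewrite inE; exists t => //; have := @pickle_invK S i; rewrite E.
rewrite esum_image; last by move=> x y _ _; exact: (pcan_inj pickleK).
by apply: eq_esum => t _; rewrite a_pickle.
Qed.

Let cS h n : c h n.+1 = c h n + a h n.
Proof. by rewrite /c big_ord_recr. Qed.

Let c_homo h m n : (m <= n)%N -> c h m <= c h n.
Proof.
move=> mn; rewrite -(subnK mn); elim: (n - m)%N => // k IH.
by rewrite addSn cS (le_trans IH)// lerDl.
Qed.

Let cE h n : (c h n)%:E = (\sum_(0 <= i < n) (a h i)%:E)%E.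
Proof. by rewrite sumEFin big_mkord. Qed.

Let c_le1 h n : c h n <= 1.
Proof.
rewrite -lee_fin cE -(a_sum h); apply: nneseries_lim_ge => i _.
by rewrite lee_fin.
Qed.

Let c_gt h y : y < 1 -> exists n, y < c h n.
Proof.
move=> y1; apply/not_existsP => cy.
have: (\sum_(i <oo) (a h i)%:E <= y%:E)%E.
  apply: lime_le.
    by apply: is_cvg_nneseries => i _ _; rewrite lee_fin.
  by apply: nearW => n; rewrite -cE lee_fin leNgt; apply/negP/cy.
by rewrite a_sum lee_fin leNgt y1.
Qed.

Let cumq_le1 h t : cum h t + q h t <= 1.
Proof. by rewrite -a_pickle -cS. Qed.

Let cum_ge0 h t : 0 <= cum h t.
Proof. by apply: sumr_ge0. Qed.

Let slot (h : seq S) (l r x : R) : set S :=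
  [set t | l + r * cum h t <= x < l + r * cum h t + r * q h t].

Let slot_ex h l r x : l <= x < l + r -> exists t, slot h l r x t.
Proof.
move=> /andP[lx xr].
have r0 : 0 < r by rewrite -(ltrD2l l) addr0 (le_lt_trans lx).
set y := (x - l) / r.
have y0 : 0 <= y by rewrite divr_ge0 ?subr_ge0// ltW.
have y1 : y < 1 by rewrite ltr_pdivrMr// mul1r ltrBlDl.
have xE : x = l + r * y by rewrite /y mulrC divfK ?gt_eqF// addrC subrK.
have := c_gt h y1; move=> yc.
case: (ex_minnP yc) => -[|m]; first by rewrite /c big_ord0 ltNge y0.
move=> ym mmin.
have cy : c h m <= y by rewrite leNgt; apply/negP => /mmin; rewrite ltnn.
have : 0 < a h m by move: ym; rewrite cS; lra.
case E: (pickle_inv m : option S) => [t|]; last by rewrite /a E ltxx.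
have tm : pickle t = m by have := @pickle_invK S m; rewrite E.
exists t; rewrite /slot/= /cum -a_pickle tm xE -addrA -mulrDr -cS.
by rewrite lerD2l ltrD2l ler_pM2l// ltr_pM2l// cy ym.
Qed.

Let slot_uniq h l r x t u : 0 <= r -> slot h l r x t -> slot h l r x u -> t = u.
Proof.
move=> r0; rewrite /slot/= /cum -!a_pickle -!addrA -!mulrDr -!cS.
move=> /andP[t1 t2] /andP[u1 u2]; apply: (pcan_inj pickleK).
apply/eqP; rewrite eqn_leq; apply/andP; split; rewrite leqNgt; apply/negP.
- move=> /(c_homo h) /(ler_wpM2l r0); lra.
- move=> /(c_homo h) /(ler_wpM2l r0); lra.
Qed.

Let len (f : nat -> S) n : R := \prod_(i < n) q (mkseq f i) (f i).
Let lo (f : nat -> S) n : R := \sum_(i < n) len f i * cum (mkseq f i) (f i).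

Let lenS f n : len f n.+1 = len f n * q (mkseq f n) (f n).
Proof. by rewrite /len big_ord_recr. Qed.

Let loS f n : lo f n.+1 = lo f n + len f n * cum (mkseq f n) (f n).
Proof. by rewrite /lo big_ord_recr. Qed.

Let len_ge0 f n : 0 <= len f n.
Proof. by apply: prodr_ge0 => i _; exact: pmf_ge0. Qed.

Let itv f n x := lo f n <= x < lo f n + len f n.

Let itvS f n x :
  itv f n.+1 x <-> slot (mkseq f n) (lo f n) (len f n) x (f n).
Proof. by rewrite /itv /slot/= loS lenS. Qed.

Let itv_le f n x : itv f n.+1 x -> itv f n x.
Proof.
move=> /itvS; rewrite /slot /itv /= => /andP[h1 h2]; apply/andP; split.
  by rewrite (le_trans _ h1)// lerDl mulr_ge0.
rewrite (lt_le_trans h2)// -addrA lerD2l -mulrDr.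
by rewrite -[leRHS]mulr1 ler_wpM2l.
Qed.

Fixpoint state (x : R) n : seq S * (R * R) :=
  if n is m.+1 then
    let: (h, (l, r)) := state x m in
    let t := xget s0 (slot h l r x) in
    (rcons h t, (l + r * cum h t, r * q h t))
  else ([::], (0, 1)).

Definition realise (x : R) : seqSpace s0 :=
  fun n => let: (h, (l, r)) := state x n in xget s0 (slot h l r x).

Let mkseqS f n : mkseq f n.+1 = rcons (mkseq f n) (f n) :> seq S.
Proof. by rewrite -cats1 /mkseq -addn1 iotaD map_cat. Qed.

Let stateE x n : state x n =
  (mkseq (realise x) n, (lo (realise x) n, len (realise x) n)).
Proof.
elim: n => [|n IH]; first by rewrite /= /lo /len !big_ord0.
rewrite mkseqS loS lenS /=.
have -> : realise x n = xget s0 (slot (mkseq (realise x) n) (lo (realise x) n)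
                                   (len (realise x) n) x).
  by rewrite {1}/realise IH.
by rewrite IH.
Qed.

Let realiseE x n : realise x n =
  xget s0 (slot (mkseq (realise x) n) (lo (realise x) n) (len (realise x) n) x).
Proof. by rewrite {1}/realise stateE. Qed.

Let realise_itv x n : 0 <= x < 1 -> itv (realise x) n x.
Proof.
move=> x01; elim: n => [|n IH].
  by rewrite /itv /lo /len !big_ord0 add0r.
apply/itvS; rewrite [X in slot _ _ _ _ X]realiseE.
by have [t ht] := slot_ex (mkseq (realise x) n) IH; apply: xgetPex; exists t.
Qed.

Let lolen_eq f g n : mkseq f n = mkseq g n -> lo f n = lo g n /\ len f n = len g n.
Proof.
elim: n => [|n IH] e; first by rewrite /lo /len !big_ord0.
move: e; rewrite !mkseqS => /rcons_inj[e fg].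
by have [e1 e2] := IH e; rewrite !loS !lenS e1 e2 e fg.
Qed.

Let itv_realise f n x : itv f n x -> mkseq (realise x) n = mkseq f n.
Proof.
elim: n => [//|n IH] hx; have {}IH := IH (itv_le hx).
rewrite !mkseqS IH realiseE IH; congr rcons.
have [-> ->] := lolen_eq IH.
move/itvS : hx => hx.
by apply: (slot_uniq (len_ge0 f n) _ hx); apply: xgetPex; exists (f n).
Qed.

Let itv01 f n x : itv f n x -> 0 <= x < 1.
Proof.
elim: n => [|n IH /itv_le/IH//].
by rewrite /itv /lo /len !big_ord0 add0r.
Qed.

Let D : set (measurableTypeR R) := `[0, 1[%classic.

Let preimage_cylinder g n : realise @^-1` (cylinder g n) `&` D =
  `[lo g n, (lo g n + len g n)[%classic.
Proof.
apply/seteqP; split=> x.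
  move=> [/= gx]; rewrite /D /= in_itv/= => x01.
  have /mkseq_eqP gx' := gx.
  have [<- <-] := lolen_eq gx'.
  by rewrite in_itv/=; exact: realise_itv.
rewrite /= in_itv/= => gx; split.
  by apply/mkseq_eqP; exact: itv_realise.
by rewrite /D /= in_itv/=; exact: itv01 gx.
Qed.

Let realise_out x : ~ D x -> realise x = fun=> s0.
Proof.
move=> xD; apply/funext => n; rewrite realiseE.
case: xgetP => // t _ ht; exfalso; apply: xD.
rewrite /D /= in_itv/=.
set f := fun i => if (i < n)%N then realise x i else t.
have fr : mkseq f n = mkseq (realise x) n.
  by apply/mkseq_eqP => i ni; rewrite /f ni.
apply: (@itv01 f n.+1); apply/itvS.
by have [-> ->] := lolen_eq fr; rewrite fr /f ltnn.
Qed.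

Let mD : measurable D.
Proof. exact: measurable_itv. Qed.

Lemma measurable_realise :
  measurable_fun [set: measurableTypeR R] (realise : _ -> seqSpace s0).
Proof.
apply: (@measurability _ _ (measurableTypeR R) (seqSpace s0) setT realise
  (cylinders s0)) => //.
move=> _ [_ [g [n ->]] <-]; rewrite setTI.
rewrite -(setIT (_ @^-1` _)) -(setvU D) setIUr.
apply: measurableU; last by rewrite preimage_cylinder; exact: measurable_itv.
have [gc|gc] := pselect (cylinder g n (fun=> s0)).
  rewrite (_ : _ `&` _ = ~` D); first exact: measurableC.
  apply/seteqP; split=> x; first by case.
  by move=> xD; split => //; rewrite /preimage/= (realise_out xD).
rewrite (_ : _ `&` _ = set0); first exact: measurable0.
apply/seteqP; split=> x // -[] /[swap] xD.
by rewrite /preimage/= (realise_out xD).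
Qed.

HB.instance Definition _ := isMeasurableFun.Build _ _ _ _
  (realise : measurableTypeR R -> seqSpace s0) measurable_realise.

Definition lebesgue01 := mrestr (@lebesgue_measure R) mD.

HB.instance Definition _ := Measure.on lebesgue01.

Let lebesgue01_setT : lebesgue01 setT = 1%E.
Proof.
rewrite /lebesgue01 /mrestr setTI.
by rewrite /D lebesgue_measure_itv/= lte_fin ltr01 oppr0 adde0.
Qed.

HB.instance Definition _ :=
  Measure_isProbability.Build _ _ _ lebesgue01 lebesgue01_setT.

Lemma law_exists : exists P : probability (seqSpace s0) R, forall g n,
  P (cylinder g n) = (\prod_(i < n) q (mkseq g i) (g i))%:E.
Proof.
exists (distribution lebesgue01
  (realise : {mfun measurableTypeR R >-> seqSpace s0})) => g n.
rewrite /= /distribution /pushforward /= /lebesgue01 /mrestr preimage_cylinder.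
rewrite lebesgue_measure_itv/= lte_fin -/(len g n) ltrDl -EFinD addrC addKr.
by case: ltgtP (len_ge0 g n) => // <-.
Qed.

End realisation.

Section run_law.
Variables (R : realType) (S : countType).

Lemma dirac_sum1 (s0 : S) :
  (\esum_(s in [set: S]) ((s == s0)%:R : R)%:E = 1)%E.
Proof.
transitivity (\esum_(s in [set s0]) ((s == s0)%:R : R)%:E)%E; last first.
  by rewrite esum_set1 ?eqxx// lee_fin.
rewrite [RHS]esum_mkcond; apply: eq_esum => s _.
by case: ifPn => [//|]; rewrite notin_setE/= => /eqP/negPf ->.
Qed.

Definition dirac_dist (s0 : S) : dist R S :=
  Dist (fun=> ler0n _ _) (dirac_sum1 s0).

Variables (M : mdp R S) (s0 : S) (sigma : strategy M).

Lemma run_law_exists :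
  exists P : probability (seqSpace s0) R, is_run_law sigma P.
Proof.
pose q h := if rev h is s :: h' then step sigma (rev h') s else dirac_dist s0.
have [P hP] := law_exists s0 q; exists P => g n g0.
rewrite hP big_ord_recl/= g0 eqxx mul1r; congr EFin.
apply: eq_bigr => i _; rewrite /q /bump/= add1n.
have -> : mkseq g i.+1 = rcons (mkseq g i) (g i).
  by rewrite -cats1 /mkseq -addn1 iotaD map_cat.
by rewrite rev_rcons revK.
Qed.

Definition run_law : probability (seqSpace s0) R := sval (cid run_law_exists).

Lemma run_lawP : is_run_law sigma run_law.
Proof. exact: svalP (cid run_law_exists). Qed.

Lemma run_law_unique (P Q : probability (seqSpace s0) R) :
  is_run_law sigma P -> is_run_law sigma Q ->
  forall A : set (seqSpace s0), measurable A -> P A = Q A.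
Proof.
move=> hP hQ A mA; pose G := cylinders s0 `|` [set set0].
have m g n : measurable (cylinder g n : set (seqSpace s0)).
  by apply: sub_sigma_algebra; exists g, n.
have start (L : probability (seqSpace s0) R) g n : is_run_law sigma L ->
    g 0%N != s0 -> L (cylinder g n.+1) = 0%E.
  move=> hL g0; apply/eqP; rewrite eq_le measure_ge0 andbT.
  have <- : L (~` cylinder (fun=> s0) 1) = 0%E.
    by rewrite probability_setC// hL// big_ord0 subee.
  apply: le_measure; rewrite ?inE; [exact: m|apply: measurableC; exact: m|].
  move=> f fg fs; move/eqP : g0; apply.
  by rewrite -(fg 0%N)// (fs 0%N).
have GE B : G B -> P B = Q B.
  move=> [[g [n ->]]|->]; last by rewrite !measure0.
  case: n => [|n].
    rewrite (_ : cylinder g 0 = setT) ?probability_setT//.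
    by apply/seteqP; split.
  have [g0|g0] := eqVneq (g 0%N) s0; first by rewrite hP// hQ.
  by rewrite !start.
apply: (@g_sigma_algebra_measure_unique _ R (seqSpace s0) G _
  (fun=> setT) _ _ P Q) => //.
- by move=> B [[g [n ->]]|->]; [exact: m|exact: measurable0].
- by move=> _; left; exists (fun=> s0), 0%N; apply/seteqP; split.
- by apply/seteqP; split=> // x _; exists 0%N.
- move=> B C [[g [n ->]]|->]; last by rewrite set0I; right.
  move=> [[g' [n' ->]]|->]; last by rewrite setI0; right.
  have [[f [fg fg']]|no] := pselect (cylinder g n `&` cylinder g' n' !=set0).
    left; exists f, (maxn n n'); apply/seteqP; split=> k /=.
      by move=> [kg kg'] i; rewrite leq_max => /orP[] ni;
        [rewrite kg// fg|rewrite kg'// fg'].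
    by move=> kf; split=> i ni; rewrite kf ?leq_max ?ni ?orbT//; auto.
  by right; apply/seteqP; split=> // k kk; exfalso; apply: no; exists k.
- move=> k; apply: (@le_lt_trans _ _ 1%E); last exact: ltry.
  exact: (@probability_le1 _ (seqSpace s0) R P setT measurableT).
- apply: (sub_smallest2r (@smallest_sigma_algebra _ setT G) _ mA).
  by move=> B; left.
Qed.

End run_law.

Arguments run_law {R S} M s0 sigma.

Section objectives.
Variables (R : realType) (S : countType) (M : mdp R S).

(* Objectives are sets of runs, i.e. of sequences that follow transitions. *)
Definition runs : set (nat -> S) := [set f | forall i, trans M (f i) (f i.+1)].

Definition Safety (T : set S) : set (nat -> S) :=
  [set f | runs f /\ forall i, ~ T (f i)].

Definition Transience : set (nat -> S) :=
  [set f | runs f /\ forall s, finite_set [set i | f i = s]].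

Definition universally_transient :=
  forall s0 (sigma : strategy M), run_law M s0 sigma Transience = 1%E.

Definition value (phi : set (nat -> S)) (s : S) : \bar R :=
  ereal_sup [set run_law M s sigma phi | sigma in [set: strategy M]].

End objectives.

Section measurability.
Variables (R : realType) (S : countType) (M : mdp R S) (s0 : S).

Lemma measurable_coord n (U : set S) :
  measurable ([set f | U (f n)] : set (seqSpace s0)).
Proof.
rewrite (_ : [set f | U (f n)] = \bigcup_(w : seq S)
    if `[< U (nth s0 w n) >] then cylinder (nth s0 w) n.+1 else set0).
  apply: countable_bigcupT_measurable => // w; case: ifP => _ //.
  by apply: sub_sigma_algebra; exists (nth s0 w), n.+1.
apply/seteqP; split=> f /=.
  move=> Uf; exists (mkseq f n.+1) => //; rewrite nth_mkseq// asboolT// => i ni.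
  by rewrite nth_mkseq.
by move=> [w _]; case: asboolP => // Uw /(_ n (ltnSn n)) ->.
Qed.

Lemma measurable_runs : measurable (runs M : set (seqSpace s0)).
Proof.
rewrite (_ : runs M = \bigcap_i \bigcap_(s : S)
  (~` [set f | f i = s] `|` [set f | trans M s (f i.+1)])).
  apply: bigcapT_measurable => i; rewrite -[X in measurable X]setCK setC_bigcap.
  apply: measurableC; apply: countable_bigcupT_measurable => // s.
  apply: measurableC; apply: measurableU.
    by apply: measurableC; exact: (measurable_coord i [set s]).
  exact: (measurable_coord i.+1 (trans M s)).
apply/seteqP; split=> f /=.
  by move=> Mf i _ s _; have [<-|] := pselect (f i = s); [right; exact: Mf|left].
by move=> Mf i; have [/(_ erefl)|] := Mf i I (f i) I.
Qed.

Lemma measurable_Safety (T : set S) :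
  measurable (Safety M T : set (seqSpace s0)).
Proof.
rewrite (_ : Safety M T = runs M `&` \bigcap_i [set f | (~` T) (f i)]).
  apply: measurableI; first exact: measurable_runs.
  by apply: bigcapT_measurable => i; exact: measurable_coord.
apply/seteqP; split=> f [Mf nT]; split=> // i; first by move=> _; exact: nT.
exact: (nT i I).
Qed.

Lemma measurable_Transience : measurable (Transience M : set (seqSpace s0)).
Proof.
rewrite (_ : Transience M = runs M `&` \bigcap_(s : S) \bigcup_n \bigcap_k
    [set f | (k < n)%N \/ (~` [set s]) (f k)]).
  apply: measurableI; first exact: measurable_runs.
  rewrite -[X in measurable X]setCK setC_bigcap.
  apply: measurableC; apply: countable_bigcupT_measurable => // s.
  apply: measurableC; apply: bigcupT_measurable => n.
  apply: bigcapT_measurable => k.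
  exact: (measurable_coord k [set t | (k < n)%N \/ (~` [set s]) t]).
apply/seteqP; split=> f [Mf ff]; split=> // s.
  move=> _; have [ks kE] := (finite_seqP _).1 (ff s).
  exists (\max_(k <- ks) k).+1 => // k _; have [fk|] := pselect (f k = s).
    left; rewrite ltnS; apply: leq_bigmax_seq => //.
    by have : [set i | f i = s] k by []; rewrite kE.
  by right.
have [n _ hn] := ff s I.
apply: (@sub_finite_set _ _ `I_n); last exact: finite_II.
by move=> k /= fk; have [//|/(_ fk)] := hn k I.
Qed.

End measurability.

(* Main.v *)
Require Import Defs.
From HB Require Import structures.
From mathcomp Require Import all_boot all_order all_algebra.
From mathcomp Require Import all_classical all_reals all_analysis.
From mathcomp Require Import ring lra.

(* Let [hitp s x] be the optimal probability of reaching [s] from [x], and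
   [ret s] the optimal probability of returning to [s].  If [ret s] were 1,
   strategies returning with probability close enough to 1 in the successive
   cycles could be concatenated into one that visits [s] infinitely often with
   positive probability, against universal transience; so [ret s < 1].  Hence,
   if each visit of [s] costs [w s * (1 - ret s)], the total expected cost from
   [x] is at most [loss x = \sum_s w s * hitp s x] under every strategy, and
   [loss <= eps] for weights [w] of sum at most [eps].  The MD strategy that
   gives up at most this cost of the safety value [v] at each visit of a
   controlled state makes [v - loss] a submartingale up to hitting [T]; since
   [v] is at most 1 and vanishes on [T], the run is safe from [s] with
   probability at least [v s - loss s]. *)

Set Implicit Arguments.
Unset Strict Implicit.
Unset Printing Implicit Defensive.

Import Order.TTheory GRing.Theory Num.Theory.

Local Open Scope classical_set_scope.
Local Open Scope ring_scope.

(** * Unordered sums of nonnegative extended reals *)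

Section esum_extra.
Context {R : realType}.

Lemma esumZl_le {I : choiceType} (c : R) (a : I -> \bar R) :
  0 <= c -> (forall i, 0 <= a i)%E ->
  (\esum_(i in [set: I]) (c%:E * a i) <= c%:E * \esum_(i in [set: I]) a i)%E.
Proof.
move=> c0 a0; apply: ge_ereal_sup => _ [X [finX _]] <-.
rewrite -ge0_mule_fsumr; last by move=> i; exact: a0.
apply: lee_wpmul2l; first by rewrite lee_fin.
by apply: esum_ge; exists X.
Qed.

(** For [c > 0] the converse inequality is [esumZl_le] applied to the factor [c^-1]. *)
Lemma esumZl {I : choiceType} (c : R) (a : I -> \bar R) :
  0 <= c -> (forall i, 0 <= a i)%E ->
  (\esum_(i in [set: I]) (c%:E * a i) = c%:E * \esum_(i in [set: I]) a i)%E.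
Proof.
move=> c0 a0; apply/eqP; rewrite eq_le esumZl_le//=.
have [->|cn0] := eqVneq c 0.
  by rewrite mul0e esum_ge0// => i _; rewrite mul0e.
have {cn0}c0 : 0 < c by rewrite lt_neqAle eq_sym cn0.
rewrite -(@lee_pmul2l _ c^-1%:E) ?lte_fin ?invr_gt0//.
rewrite muleA -EFinM mulVf ?gt_eqF// mul1e.
apply: le_trans (esumZl_le (ltW _) _); last 2 first.
- by rewrite invr_gt0.
- by move=> i; rewrite mule_ge0// lee_fin ltW.
by apply: le_esum => i _; rewrite muleA -EFinM mulVf ?gt_eqF// mul1e.
Qed.

Lemma esum_exchange {I J : choiceType} (a : I -> J -> \bar R) :
  (forall i j, 0 <= a i j)%E ->
  (\esum_(i in [set: I]) \esum_(j in [set: J]) a i j =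
   \esum_(j in [set: J]) \esum_(i in [set: I]) a i j)%E.
Proof.
move=> a0; rewrite esum_esum// [RHS]esum_esum//.
apply: (@reindex_esum _ _ _ _ _ (fun p : J * I => (p.2, p.1))
  (fun p : I * J => a p.1 p.2)).
split=> //; first by move=> [i j] [i' j'] _ _ [-> ->].
by move=> [i j] _; exists (j, i).
Qed.

Lemma esum_pickle {I : countType} (a : I -> \bar R) :
  (forall i, 0 <= a i)%E ->
  (\esum_(i in [set: I]) a i =
   \sum_(n <oo) oapp a 0 (pickle_inv n : option I))%E.
Proof.
move=> a0; rewrite nneseries_esumT; last by move=> n; case: pickle_inv.
transitivity (\esum_(n in pickle @` [set: I])
    oapp a 0 (pickle_inv n : option I))%E.
  rewrite esum_image; last by move=> x y _ _; exact: (pcan_inj pickleK).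
  by apply: eq_esum => t _; rewrite pickleK_inv.
rewrite esum_mkcond; apply: eq_esum => n _; case: ifPn => // /negP ni.
case E: (pickle_inv n : option I) => [t|] //=; exfalso; apply: ni.
by rewrite inE; exists t => //; have := @pickle_invK I n; rewrite E.
Qed.

End esum_extra.

Lemma dist_ge0 (R : realType) (S : countType) (q : dist R S) t : 0 <= q t.
Proof. exact: Defs.pmf_ge0. Qed.

(** * Expectations of bounded functions under one-step laws *)

Section expectation.
Context {R : realType} {S : countType}.
Implicit Types (q : dist R S) (f g : S -> R).

(** This condition makes the sum behind [Ex] finite, so that [fine] does not fall back on its
    default value. *)
Definition nnbounded f := (forall t, 0 <= f t) /\ exists C, forall t, f t <= C.

Definition Ex q f : R := fine (\esum_(t in [set: S]) (q t * f t)%:E)%E.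

Lemma nnbounded_cst (c : R) : 0 <= c -> nnbounded (fun=> c).
Proof. by move=> c0; split=> //; exists c. Qed.

Lemma nnboundedD f g : nnbounded f -> nnbounded g -> nnbounded (f \+ g).
Proof.
move=> [f0 [C fC]] [g0 [D gD]]; split=> [t|]; first by rewrite addr_ge0.
by exists (C + D) => t; rewrite lerD.
Qed.

Lemma ExE q f : nnbounded f ->
  (Ex q f)%:E = (\esum_(t in [set: S]) (q t * f t)%:E)%E.
Proof.
move=> [f0 [C fC]].
have E0 : (0 <= \esum_(t in [set: S]) (q t * f t)%:E)%E.
  by apply: esum_ge0 => t _; rewrite lee_fin mulr_ge0 ?dist_ge0//.
rewrite /Ex fineK// ge0_fin_numE//.
apply: (@le_lt_trans _ _ (\esum_(t in [set: S]) (`|C|%:E * (q t)%:E))%E).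
  apply: le_esum => t _; rewrite -EFinM lee_fin mulrC.
  by apply: ler_wpM2r; [exact: dist_ge0|exact: le_trans (fC t) (ler_norm C)].
by rewrite esumZl// ?pmf_sum1 ?mule1 ?ltry// => t; rewrite lee_fin dist_ge0.
Qed.

Lemma Ex_ge0 q f : nnbounded f -> 0 <= Ex q f.
Proof.
move=> bf; rewrite -lee_fin ExE//; apply: esum_ge0 => t _.
by rewrite lee_fin mulr_ge0 ?dist_ge0//; case: bf.
Qed.

Lemma Ex_le q f g : nnbounded f -> nnbounded g ->
  (forall t, 0 < q t -> f t <= g t) -> Ex q f <= Ex q g.
Proof.
move=> bf bg fg; rewrite -lee_fin !ExE//; apply: le_esum => t _.
rewrite lee_fin; have [->|qt0] := eqVneq (q t) 0; first by rewrite !mul0r.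
have qt : 0 < q t by rewrite lt_neqAle eq_sym qt0 dist_ge0.
by rewrite ler_pM2l// fg.
Qed.

Lemma ExD q f g : nnbounded f -> nnbounded g ->
  Ex q (f \+ g) = Ex q f + Ex q g.
Proof.
move=> bf bg; apply: EFin_inj; rewrite EFinD !ExE//; last exact: nnboundedD.
rewrite -esumD => [|t _|t _]; last 2 first.
- by rewrite lee_fin mulr_ge0 ?dist_ge0//; case: bf.
- by rewrite lee_fin mulr_ge0 ?dist_ge0//; case: bg.
by apply: eq_esum => t _; rewrite -EFinD mulrDr.
Qed.

Lemma Ex_cst q (c : R) : 0 <= c -> Ex q (fun=> c) = c.
Proof.
move=> c0; apply: EFin_inj; rewrite ExE; last exact: nnbounded_cst.
rewrite -[RHS]mule1 -(pmf_sum1 q) -esumZl// => [|t]; last first.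
  by rewrite lee_fin dist_ge0.
by apply: eq_esum => t _; rewrite -EFinM mulrC.
Qed.

Lemma Ex_le_cst q f (c : R) : 0 <= c -> nnbounded f ->
  (forall t, 0 < q t -> f t <= c) -> Ex q f <= c.
Proof.
move=> c0 bf fc; rewrite -[leRHS](Ex_cst q c0).
by apply: Ex_le => //; exact: nnbounded_cst.
Qed.

Lemma Ex_esum {I : choiceType} q (c : I -> R) (h : I -> S -> R) (f : S -> R) :
  (forall i, 0 <= c i) -> (forall i, nnbounded (h i)) -> nnbounded f ->
  (forall t, (f t)%:E = \esum_(i in [set: I]) (c i * h i t)%:E)%E ->
  ((Ex q f)%:E = \esum_(i in [set: I]) (c i * Ex q (h i))%:E)%E.
Proof.
move=> c0 bh bf fE; rewrite ExE//.
have chq i t : 0 <= c i * h i t by rewrite mulr_ge0 ?dist_ge0//; case: (bh i).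
transitivity (\esum_(t in [set: S]) \esum_(i in [set: I])
    ((q t)%:E * (c i * h i t)%:E))%E.
  apply: eq_esum => t _; rewrite EFinM fE esumZl ?dist_ge0// => i.
  by rewrite lee_fin.
rewrite esum_exchange => [|t i]; last by rewrite mule_ge0// lee_fin ?dist_ge0//.
apply: eq_esum => i _; rewrite EFinM ExE// -esumZl// => [|t].
  by apply: eq_esum => t _; rewrite -!EFinM mulrCA.
by rewrite lee_fin mulr_ge0 ?dist_ge0//; case: (bh i).
Qed.

(** Monotone convergence: the sum is a supremum over finite sets, and on a finite set a single index
    brings [f n] within [e] of [g] at every point. *)
Lemma Ex_sup_le q (f : nat -> S -> R) (g : S -> R) (c : R) :
  nnbounded g -> (forall n t, 0 <= f n t <= g t) ->
  {homo f : m n / (m <= n)%N >-> forall t, m t <= n t} ->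
  (forall t e, 0 < e -> exists n, g t - e < f n t) ->
  (forall n, Ex q (f n) <= c) -> Ex q g <= c.
Proof.
move=> bg f0g fmono fg fc; rewrite -lee_fin ExE//.
have bf n : nnbounded (f n).
  have [_ [C gC]] := bg; split=> [t|]; first by case/andP: (f0g n t).
  by exists C => t; apply: le_trans (gC t); case/andP: (f0g n t).
apply: ge_ereal_sup => _ [X [finX _]] <-; apply/lee_addgt0Pr => e e0.
have [n hn] : exists n, forall t, X t -> g t - e < f n t.
  have [s ->] := (finite_seqP _).1 finX.
  elim: s => [|t s [n IH]]; first by exists 0%N.
  have [m hm] := fg t e e0; exists (maxn m n) => u /=.
  rewrite inE => /predU1P[->|us].
    by apply: (lt_le_trans hm); apply: fmono; exact: leq_maxl.
  by apply: (lt_le_trans (IH _ us)); apply: fmono; exact: leq_maxr.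
have be := nnbounded_cst (ltW e0).
apply: (@le_trans _ _ (Ex q (f n \+ fun=> e))%:E); last first.
  by rewrite (ExD _ (bf n) be) (Ex_cst _ (ltW e0)) -EFinD lee_fin lerD2r.
rewrite ExE; last exact: nnboundedD.
apply: esum_ge; exists X => //; apply: lee_fsum => // t Xt.
rewrite lee_fin; apply: ler_wpM2l; first exact: dist_ge0.
by rewrite /= -lerBlDr ltW// hn.
Qed.

(** Determinization: a randomized choice of good mean contains a single successor that is as
    good. *)
Lemma Ex_gt_ex q f (c : R) : nnbounded f -> 0 <= c -> c < Ex q f ->
  exists2 t, 0 < q t & c < f t.
Proof.
move=> bf c0 cE; apply: contrapT => no.
move: cE; apply/negP; rewrite -leNgt; apply: Ex_le_cst => // t qt.
by rewrite leNgt; apply/negP => ct; apply: no; exists t.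
Qed.

Lemma Ex_dirac f (t : S) : nnbounded f -> Ex (dirac_dist R t) f = f t.
Proof.
move=> bf; have [f0 _] := bf; apply/eqP; rewrite eq_le; apply/andP; split.
  apply: Ex_le_cst => // u /=; case: eqP => [->//|_].
  by rewrite ltxx.
rewrite -lee_fin ExE//; apply: esum_ge; exists [set t].
  by split.
by rewrite fsbig_set1/= eqxx mul1r.
Qed.

End expectation.

(** * Run laws on cylinders and their one-step decomposition *)

Section run_laws.
Context {R : realType} {S : countType} (M : mdp R S) (s0 : S).
Context (sigma : strategy M) (P : probability (seqSpace s0) R).
Hypothesis P_law : is_run_law sigma P.

Lemma mkseq_rcons (g : nat -> S) n : mkseq g n.+1 = rcons (mkseq g n) (g n).
Proof. by rewrite -cats1 /mkseq -addn1 iotaD map_cat. Qed.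

(** There are countably many finite words, so a set decided by the first [n] coordinates is a
    countable union of cylinders. *)
Lemma measurable_prefix n (A : set (seqSpace s0)) :
  (forall f g : nat -> S, (forall i, (i < n)%N -> f i = g i) -> A f -> A g) ->
  measurable A.
Proof.
move=> A_prefix; rewrite (_ : A = \bigcup_(w : seq S)
    if `[< A (nth s0 w) >] then cylinder (nth s0 w) n else set0).
  apply: countable_bigcupT_measurable => // w; case: ifP => _ //.
  by apply: sub_sigma_algebra; exists (nth s0 w), n.
apply/seteqP; split=> f.
  move=> Af; exists (mkseq f n) => //; rewrite asboolT.
    by move=> i ni; rewrite nth_mkseq.
  by apply: A_prefix Af => i ni; rewrite nth_mkseq.
move=> [w _]; case: asboolP => // Aw fw; apply: A_prefix Aw => i /fw ->//.
Qed.

Lemma measurable_cylinder g n :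
  measurable (cylinder g n : set (seqSpace s0)).
Proof. by apply: sub_sigma_algebra; exists g, n. Qed.

(** Countable additivity is indexed by [nat], so coordinate [m] is split by its code; numbers coding
    no state give empty sets. *)
Lemma prob_coord_esum (A : set (seqSpace s0)) m : measurable A ->
  P A = (\esum_(t in [set: S]) P (A `&` [set f | f m = t]))%E.
Proof.
move=> mA; pose F n : set (seqSpace s0) := A `&` [set f | pickle (f m) = n].
have mF n : measurable (F n).
  by apply: measurableI => //; exact: (measurable_coord m [set x | pickle x = n]).
rewrite esum_pickle => [|t]; last exact: measure_ge0.
rewrite [LHS](_ : _ = P (\bigcup_n F n)); last first.
  congr (P _); apply/seteqP; split=> [f Af|f [n _ []]//].
  by exists (pickle (f m)).
rewrite measure_bigcup//.
  rewrite (eq_eseriesl (Q := xpredT)) => [|n]; last by rewrite in_setT.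
  apply: eq_eseriesr => n _ /=.
  case E: (pickle_inv n : option S) => [t|] /=; last first.
    rewrite [F n](_ : _ = set0) ?measure0//; apply/seteqP; split=> // f [_ /= fn].
    by move: E; rewrite -fn pickleK_inv.
  have tn : pickle t = n by have := @pickle_invK S n; rewrite E.
  congr (P _); apply/seteqP; split=> f [Af /= fn]; split=> //=.
    by apply: (pcan_inj pickleK); rewrite fn tn.
  by rewrite fn tn.
by move=> i j _ _ [f [[_ <-] [_ <-]]].
Qed.

Definition extend (g : nat -> S) m t : nat -> S :=
  fun i => if (i <= m)%N then g i else t.

Lemma cylinder_extend g m t :
  cylinder g m.+1 `&` [set f | f m.+1 = t] = cylinder (extend g m t) m.+2.
Proof.
apply/seteqP; split=> f /=.
  move=> [fg <-] i; rewrite ltnS /extend; case: (leqP i m) => [im _|mi im].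
    exact: fg.
  by congr f; apply/eqP; rewrite eqn_leq im.
move=> fg; split; last by rewrite fg// /extend ltnn.
by move=> i im; rewrite fg 1?ltnW// /extend -ltnS im.
Qed.

Lemma mkseq_extend g m t : mkseq (extend g m t) m.+1 = mkseq g m.+1.
Proof. by apply/mkseq_eqP => i im; rewrite /extend -ltnS im. Qed.

Lemma prob_extend g m t : g 0%N = s0 ->
  P (cylinder (extend g m t) m.+2) =
  (P (cylinder g m.+1) * (step sigma (mkseq g m) (g m) t)%:E)%E.
Proof.
move=> g0; rewrite !P_law// -EFinM big_ord_recr/=; congr EFin; congr (_ * _).
  apply: eq_bigr => i _; rewrite /extend (ltnW (ltn_ord i)) (ltn_ord i).
  congr (step _ _ _ _); apply/mkseq_eqP => j ji.
  by rewrite (leq_trans (ltnW ji) (ltnW (ltn_ord i))).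
rewrite {2 3}/extend leqnn ltnn; congr (step _ _ _ _).
by apply/mkseq_eqP => j jm; rewrite /extend ltnW.
Qed.

Lemma prob_start : P (cylinder (fun=> s0) 1) = 1%E.
Proof. by rewrite P_law// big_ord0. Qed.

(** * A submartingale bound for a property that holds at all times *)

Section potential.
Variables (W : seq S -> S -> R) (G : seq S -> S -> Prop).
Hypothesis W01 : forall rho x, 0 <= W rho x <= 1.
Hypothesis W_good : forall rho x, 0 < W rho x -> G rho x.
Hypothesis W_step : forall rho x,
  W rho x <= Ex (step sigma rho x) (W (rcons rho x)).

Definition good_during m n : set (seqSpace s0) :=
  [set f | forall i, (m <= i <= m + n)%N -> G (mkseq f i) (f i)].

Lemma measurable_good_during m n : measurable (good_during m n).
Proof.
apply: (@measurable_prefix (m + n).+1) => f g fg fG i /[dup] iN /fG.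
case/andP: iN => _ iN; rewrite fg ?ltnS//.
suff -> : mkseq f i = mkseq g i by [].
by apply/mkseq_eqP => j ji; rewrite fg// ltnS ltnW// (leq_trans ji).
Qed.

(** [W] bounds from below the conditional probability that [G] persists for [n] more steps. The
    induction splits the cylinder by the next state and averages the bounds with [W_step]. *)
Lemma potential_good_during n m g : g 0%N = s0 ->
  (P (cylinder g m.+1) * (W (mkseq g m) (g m))%:E <=
   P (cylinder g m.+1 `&` good_during m n))%E.
Proof.
elim: n m g => [|n IH] m g g0.
  (* Where [W] vanishes the left side is 0; elsewhere [W_good] yields [G] at time [m]. *)
  have [Wpos|] := ltP 0 (W (mkseq g m) (g m)); last first.
    case/andP: (W01 (mkseq g m) (g m)) => W0 _ W0'.
    by rewrite (le_anti (introT andP (conj W0' W0))) mule0.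
  rewrite (_ : _ `&` _ = cylinder g m.+1).
    rewrite -[leRHS]mule1 lee_wpmul2l// lee_fin.
    by case/andP: (W01 (mkseq g m) (g m)).
  apply/seteqP; split=> [f []//|f fg]; split=> // i.
  rewrite addn0 -eqn_leq => /eqP <-; rewrite fg//.
  have -> : mkseq f m = mkseq g m by apply/mkseq_eqP => j jm; rewrite fg// ltnW.
  exact: W_good.
have [Wpos|] := ltP 0 (W (mkseq g m) (g m)); last first.
  case/andP: (W01 (mkseq g m) (g m)) => W0 _ W0'.
  by rewrite (le_anti (introT andP (conj W0' W0))) mule0.
have bW rho : nnbounded (W rho).
  split=> [t|]; first by case/andP: (W01 rho t).
  by exists 1 => t; case/andP: (W01 rho t).
have Pg : P (cylinder g m.+1) =
    (\prod_(i < m) step sigma (mkseq g i) (g i) (g i.+1))%:E by rewrite P_law.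
have Pg0 : 0 <= \prod_(i < m) step sigma (mkseq g i) (g i) (g i.+1).
  by apply: prodr_ge0 => i _; exact: dist_ge0.
apply: (@le_trans _ _ (P (cylinder g m.+1) *
    (Ex (step sigma (mkseq g m) (g m)) (W (mkseq g m.+1)))%:E)%E).
  by rewrite lee_wpmul2l// lee_fin mkseq_rcons.
have mA : measurable
    (cylinder g m.+1 `&` good_during m n.+1 : set (seqSpace s0)).
  by apply: measurableI; [exact: measurable_cylinder|exact: measurable_good_during].
rewrite (prob_coord_esum m.+1 mA) ExE// Pg -esumZl// => [|t]; last first.
  by rewrite lee_fin mulr_ge0 ?dist_ge0//; case: (bW (mkseq g m.+1)).
apply: le_esum => t _.
have := IH m.+1 (extend g m t) g0.
have -> : extend g m t m.+1 = t by rewrite /extend ltnn.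
rewrite mkseq_extend prob_extend// Pg EFinM muleA => /le_trans; apply.
apply: le_measure; rewrite ?inE.
- by apply: measurableI; [exact: measurable_cylinder|exact: measurable_good_during].
- by apply: measurableI => //; exact: (measurable_coord m.+1 [set t]).
(* The induction hypothesis covers the times from [m.+1] on; at time [m] itself [G] comes from
   [Wpos]. *)
rewrite -cylinder_extend => f [[fg ft] fG]; split=> //; split=> // i /andP[mi iN].
move: mi; rewrite leq_eqVlt => /predU1P[<-|mi]; last by apply: fG; rewrite mi addSnnS.
rewrite fg//; have -> : mkseq f m = mkseq g m.
  by apply/mkseq_eqP => j jm; rewrite fg// ltnW.
exact: W_good.
Qed.

Definition good_forever : set (seqSpace s0) :=
  [set f | forall i, G (mkseq f i) (f i)].

Lemma good_foreverE : good_forever = \bigcap_n good_during 0 n.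
Proof.
apply/seteqP; split=> f fG; first by move=> n _ i _; exact: fG.
by move=> i; apply: (fG i I); rewrite add0n leqnn.
Qed.

Lemma measurable_good_forever : measurable good_forever.
Proof.
rewrite good_foreverE; apply: bigcapT_measurable => n.
exact: measurable_good_during.
Qed.

(** Continuity from above, along the decreasing events that [G] holds up to time [n]. *)
Lemma potential_good : ((W [::] s0)%:E <= P good_forever)%E.
Proof.
have mF n := measurable_good_during 0 n.
have cF : P (good_during 0 n) @[n --> \oo] --> P good_forever.
  rewrite good_foreverE; apply: nonincreasing_cvg_mu => //.
  - by rewrite (le_lt_trans (probability_le1 P (mF 0%N)))// ltry.
  - exact: bigcapT_measurable.
  - move=> m n mn; apply/subsetPset => f fG i /andP[_ im]; apply: fG => /=.
    exact: leq_trans im _.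
rewrite -(cvg_lim _ cF)//; apply: lime_ge; first exact: cvgP cF.
apply: nearW => n; have := @potential_good_during n 0 (fun=> s0) erefl.
rewrite prob_start mul1e => /le_trans; apply; apply: le_measure; rewrite ?inE//.
by apply: measurableI => //; exact: measurable_cylinder.
Qed.

End potential.
End run_laws.

(** * Optimal probabilities of reaching and of returning to a state *)

Section hitting.
Context {R : realType} {S : countType} (M : mdp R S).

(** The laws that can govern a move from [x]; optimizing over them treats controlled and random
    states alike. *)
Definition act x (q : dist R S) : Prop :=
  if ctrl M x then forall t, 0 < q t -> trans M x t else q = prob M x.

Lemma act_trans x q t : act x q -> 0 < q t -> trans M x t.
Proof.
rewrite /act; case: ifPn => [_|xr ->]; first exact.
exact: prob_trans.
Qed.

Lemma act_step (sigma : strategy M) rho x : act x (step sigma rho x).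
Proof.
rewrite /act /step; case: (boolP (ctrl M x)) => // xc t.
exact: decision_trans.
Qed.

Lemma act_dirac x t : ctrl M x -> trans M x t -> act x (dirac_dist R t).
Proof.
move=> xc xt; rewrite /act xc => u /=; case: eqP => [->//|_].
by rewrite ltxx.
Qed.

Lemma act_ex x : exists q, act x q.
Proof.
have [xc|xr] := boolP (ctrl M x).
  have [t xt] := trans_total M x.
  by exists (dirac_dist R t); exact: act_dirac.
by exists (prob M x); rewrite /act (negbTE xr).
Qed.

Lemma strategy_ex (c : seq S -> S -> dist R S) :
  (forall rho x, act x (c rho x)) ->
  exists sigma : strategy M, (forall rho x, sigma rho x = c rho x) /\
    forall rho x, step sigma rho x = c rho x.
Proof.
move=> cact; have ctrans rho x t : ctrl M x -> 0 < c rho x t -> trans M x t.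
  by move=> xc; move: (cact rho x); rewrite /act xc; exact.
exists (Strategy ctrans); split=> // rho x; rewrite /step /=.
by case: ifPn => // xr; move: (cact rho x); rewrite /act (negbTE xr).
Qed.

(** Value iteration for reaching [s] within [n] steps; the recursion involves no measure on runs. *)
Fixpoint hit (s : S) n x : R :=
  if x == s then 1
  else if n is m.+1 then sup [set Ex q (hit s m) | q in act x] else 0.

Lemma hit_self s n : hit s n s = 1.
Proof. by case: n => [|n] /=; rewrite eqxx. Qed.

Lemma hit_bounds s n x : 0 <= hit s n x <= 1.
Proof.
elim: n x => [|n IH] x /=; first by case: eqP => _; rewrite ?lexx ?ler01.
case: eqP => _; first by rewrite lexx ler01.
have bh : nnbounded (hit s n).
  by split=> [t|]; [|exists 1 => t]; case/andP: (IH t).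
have [q0 aq0] := act_ex x.
have le1 q : act x q -> Ex q (hit s n) <= 1.
  by move=> _; apply: Ex_le_cst => // t _; case/andP: (IH t).
apply/andP; split.
  apply: (@le_trans _ _ (Ex q0 (hit s n))); first exact: Ex_ge0.
  by apply: ub_le_sup; [exists 1 => _ [q /le1 ? <-]|exists q0].
apply: ge_sup; first by exists (Ex q0 (hit s n)), q0.
by move=> _ [q /le1 ? <-].
Qed.

Lemma hit_ge0 s n x : 0 <= hit s n x.
Proof. by case/andP: (hit_bounds s n x). Qed.

Lemma hit_le1 s n x : hit s n x <= 1.
Proof. by case/andP: (hit_bounds s n x). Qed.

Lemma nnbounded_hit s n : nnbounded (hit s n).
Proof. by split=> [t|]; [exact: hit_ge0|exists 1 => t; exact: hit_le1]. Qed.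

Lemma Ex_hit_le1 s n q : Ex q (hit s n) <= 1.
Proof.
by apply: Ex_le_cst => //; [exact: nnbounded_hit|move=> t _; exact: hit_le1].
Qed.

Lemma hit_step s n x q : x != s -> act x q -> Ex q (hit s n) <= hit s n.+1 x.
Proof.
move=> /negbTE /= -> aq; apply: ub_le_sup; last by exists q.
by exists 1 => _ [p _ <-]; exact: Ex_hit_le1.
Qed.

(** The margin [d] is there because a supremum over infinitely many laws need not be attained. *)
Lemma hit_adherent s n x d : x != s -> 0 < d ->
  exists2 q, act x q & hit s n.+1 x - d < Ex q (hit s n).
Proof.
move=> /negbTE /= -> d0.
have [|_ [q aq <-] hq] := @sup_adherent _ [set Ex q (hit s n) | q in act x] _ d0.
  split; first by have [q aq] := act_ex x; exists (Ex q (hit s n)), q.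
  by exists 1 => _ [p _ <-]; exact: Ex_hit_le1.
by exists q.
Qed.

Lemma hit_homo s : {homo hit s : m n / (m <= n)%N >-> forall t, m t <= n t}.
Proof.
apply: homo_leq => [f t //|g f h fg gh t|n]; first exact: le_trans (fg t) (gh t).
elim: n => [|n IH] t.
  rewrite /hit -/hit; case: eqP => // ts; have [q aq] := act_ex t.
  have := hit_step 0 (introN eqP ts) aq; rewrite /= (introF eqP ts).
  by apply: le_trans; apply: Ex_ge0; exact: (nnbounded_hit s 0).
have [->|ts] := eqVneq t s; first by rewrite !hit_self.
apply/ler_addgt0Pr => d d0; have [q aq] := hit_adherent n ts d0.
rewrite ltrBlDr => /ltW /le_trans; apply; rewrite lerD2r.
apply: le_trans (hit_step n.+1 ts aq).
by apply: Ex_le => [||u _]; [exact: nnbounded_hit|exact: nnbounded_hit|exact: IH].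
Qed.

Definition hitp s x : R := sup (range (fun n => hit s n x)).

Lemma hit_le_hitp s n x : hit s n x <= hitp s x.
Proof.
by apply: ub_le_sup; [exists 1 => _ [m _ <-]; exact: hit_le1|exists n].
Qed.

Lemma hitp_le s x c : (forall n, hit s n x <= c) -> hitp s x <= c.
Proof. by move=> hc; apply: ge_sup; [exists (hit s 0 x), 0%N|move=> _ [n _ <-]]. Qed.

Lemma hitp_ge0 s x : 0 <= hitp s x.
Proof. exact: le_trans (hit_ge0 s 0 x) (hit_le_hitp s 0 x). Qed.

Lemma hitp_le1 s x : hitp s x <= 1.
Proof. by apply: hitp_le => n; exact: hit_le1. Qed.

Lemma hitp_self s : hitp s s = 1.
Proof.
apply/eqP; rewrite eq_le hitp_le1 /=.
by rewrite -[leLHS](hit_self s 0); exact: hit_le_hitp.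
Qed.

Lemma nnbounded_hitp s : nnbounded (hitp s).
Proof. by split=> [t|]; [exact: hitp_ge0|exists 1 => t; exact: hitp_le1]. Qed.

Lemma Ex_hitp_le s q c : (forall n, Ex q (hit s n) <= c) -> Ex q (hitp s) <= c.
Proof.
apply: Ex_sup_le => [|n t||t e e0].
- exact: nnbounded_hitp.
- by rewrite hit_ge0 hit_le_hitp.
- exact: hit_homo.
- have [|_ [n _ <-] ?] := @sup_adherent _ (range (fun n => hit s n t)) _ e0.
    by split; [exists (hit s 0 t), 0%N|exists 1 => _ [m _ <-]; exact: hit_le1].
  by exists n.
Qed.

Lemma hitp_superharmonic s x q : x != s -> act x q -> Ex q (hitp s) <= hitp s x.
Proof.
move=> xs aq; apply: Ex_hitp_le => n.
exact: le_trans (hit_step n xs aq) (hit_le_hitp s n.+1 x).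
Qed.

(** A first step is taken explicitly, since [hit s n s] is 1 without any move. *)
Definition ret s : R :=
  sup [set r | exists n q, act s q /\ r = Ex q (hit s n)].

Lemma ret_nonempty s : [set r | exists n q, act s q /\ r = Ex q (hit s n)] !=set0.
Proof. by have [q aq] := act_ex s; exists (Ex q (hit s 0)), 0%N, q. Qed.

Lemma ret_bounded s :
  has_ubound [set r | exists n q, act s q /\ r = Ex q (hit s n)].
Proof. by exists 1 => _ [n [q [_ ->]]]; exact: Ex_hit_le1. Qed.

Lemma Ex_hitp_ret s q : act s q -> Ex q (hitp s) <= ret s.
Proof.
move=> aq; apply: Ex_hitp_le => n.
by apply: ub_le_sup; [exact: ret_bounded|exists n, q].
Qed.

End hitting.

(** * Return probabilities below 1 under universal transience *)

Section returning.
Context {R : realType} {S : countType} (M : mdp R S).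
Hypothesis M_transient : universally_transient M.

Section cycles.
Variables (s : S) (Q : nat -> nat * dist R S) (c : S -> nat -> R -> dist R S).
(** The exponent is chosen so that [2 * beta k] is the decrease from [2^-1 ^+ k.+1] to
    [2^-1 ^+ k.+2]. *)
Let beta k : R := 2^-1 ^+ (k + 3).
Hypothesis Q_act : forall k, act M s (Q k).2.
Hypothesis Q_ret : forall k, 1 - beta k <= Ex (Q k).2 (hit M s (Q k).1).
Hypothesis c_act : forall x m d, act M x (c x m d).
Hypothesis c_hit : forall x m d, x != s -> 0 < d ->
  hit M s m.+1 x - d <= Ex (c x m d) (hit M s m).

(* A mode [(k, m, d)] records the number [k] of past visits of [s], the number
   [m] of steps left for reaching [s] again, and the loss [d] allowed per
   step. *)
Definition next_mode (md : nat * nat * R) x : nat * nat * R :=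
  let: (k, m, d) := md in
  if x == s then (k.+1, (Q k).1, beta k / (Q k).1.+1%:R) else (k, m.-1, d).

(** The initial loss 1 is a placeholder: until the first visit of [s] no steps are left, so it is
    multiplied by 0. *)
Definition mode (rho : seq S) := foldl next_mode (0%N, 0%N, 1) rho.

(** The predecessor appears because [c x m d] is nearly optimal for horizon [m.+1]. *)
Definition mode_law (md : nat * nat * R) x : dist R S :=
  let: (k, m, d) := md in if x == s then (Q k).2 else c x m.-1 d.

(** A lower bound for the probability of returning to [s] forever: the chance of completing the
    current cycle, less the losses of its remaining steps, less the total error [2^-1 ^+ k.+1] of
    the cycles from number [k] on. *)
Definition mode_potential (md : nat * nat * R) x : R :=
  let: (k, m, d) := md in
  Num.max 0 (hit M s m x - m%:R * d - 2^-1 ^+ k.+1).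

Lemma mode_rcons rho x : mode (rcons rho x) = next_mode (mode rho) x.
Proof. by rewrite /mode -cats1 foldl_cat. Qed.

Let beta_gt0 k : 0 < beta k.
Proof. by rewrite exprn_gt0// invr_gt0 ltr0n. Qed.

Lemma mode_loss_gt0 rho : 0 < (mode rho).2.
Proof.
elim/last_ind: rho => [|rho x]; first by rewrite /= ltr01.
rewrite mode_rcons; case: (mode rho) => -[k m] d /= d0.
by case: eqP => _ //=; rewrite divr_gt0// ltr0n.
Qed.

Lemma mode_potential_bounds md x : 0 < md.2 -> 0 <= mode_potential md x <= 1.
Proof.
case: md => -[k m] d /= d0; rewrite le_max lexx/= ge_max ler01/=.
have h1 := hit_le1 M s m x.
have md0 : 0 <= m%:R * d by rewrite mulr_ge0// ltW.
have B0 : 0 <= 2^-1 ^+ k.+1 :> R by rewrite exprn_ge0// invr_ge0 ler0n.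
lra.
Qed.

Lemma nnbounded_mode_potential md : 0 < md.2 -> nnbounded (mode_potential md).
Proof.
by move=> d0; split=> [t|]; [|exists 1 => t];
  case/andP: (mode_potential_bounds t d0).
Qed.

Lemma Ex_hit_mode_potential q k m d : 0 < d ->
  Ex q (hit M s m) <=
  Ex q (mode_potential (k, m, d)) + (m%:R * d + 2^-1 ^+ k.+1).
Proof.
move=> d0; have bW := @nnbounded_mode_potential (k, m, d) d0.
have e0 : 0 <= m%:R * d + 2^-1 ^+ k.+1.
  by rewrite addr_ge0 ?mulr_ge0 ?exprn_ge0 ?invr_ge0// ltW.
rewrite -[X in _ + X](Ex_cst q e0) -ExD//; last exact: nnbounded_cst.
apply: Ex_le; [exact: nnbounded_hit|by apply: nnboundedD => //; exact: nnbounded_cst|].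
by move=> t _ /=; rewrite -lerBlDr opprD addrA le_max lexx orbT.
Qed.

(** At [s] a new cycle begins, paid for by the decrease of the reserve. Elsewhere the step counter
    falls by one, which releases the loss [d] that [c] may incur. *)
Lemma mode_potential_step md x : 0 < md.2 ->
  mode_potential md x <= Ex (mode_law md x) (mode_potential (next_mode md x)).
Proof.
case: md => -[k m] d /= d0; case: eqP => [->|/eqP xs].
  have d'0 : 0 < beta k / (Q k).1.+1%:R by rewrite divr_gt0// ltr0n.
  have bW := @nnbounded_mode_potential (k.+1, (Q k).1, beta k / (Q k).1.+1%:R) d'0.
  rewrite ge_max Ex_ge0//= hit_self.
  have := Ex_hit_mode_potential (Q k).2 k.+1 (Q k).1 d'0.
  have : (Q k).1%:R * (beta k / (Q k).1.+1%:R) <= beta k.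
    rewrite mulrCA ler_piMr ?(ltW (beta_gt0 k))//.
    by rewrite ler_pdivrMr ?ltr0n// mul1r ler_nat.
  have := Q_ret k.
  have : 0 <= m%:R * d by rewrite mulr_ge0// ltW.
  (* One [beta k] covers the suboptimality of [Q k], the other the step losses of the whole
     cycle. *)
  have : 2^-1 ^+ k.+1 = 2^-1 ^+ k.+2 + beta k + beta k :> R.
    by rewrite /beta addn3 !exprS; field.
  move: (2^-1 ^+ k.+1) (2^-1 ^+ k.+2) (_%:R * (_ / _)) (m%:R * d) => b1 b2 e1 e2.
  move: (beta k) (Ex _ (hit _ _ _)) => b h.
  by move: (Ex _ _) => e; lra.
have bW m' := @nnbounded_mode_potential (k, m', d) d0.
rewrite ge_max Ex_ge0//=.
have B0 : 0 <= 2^-1 ^+ k.+1 :> R by rewrite exprn_ge0// invr_ge0 ler0n.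
(* With no step left away from [s], the expression under the maximum is negative. *)
case: m => [|m] /=.
  rewrite (negbTE xs) mul0r subr0 sub0r.
  by apply: le_trans (Ex_ge0 _ (bW 0%N)); rewrite oppr_le0.
have := Ex_hit_mode_potential (c x m d) k m d0.
have := c_hit m xs d0; rewrite /= (negbTE xs) -[m.+1%:R]natr1 mulrDl mul1r.
move: (sup _) (2^-1 ^+ k.+1) (m%:R * d) (Ex _ (hit _ _ _)) => v b e h.
by move: (Ex _ _) => E; lra.
Qed.

(** Away from [s] the step counter runs down to 0, and there the hitting probability is 0. *)
Lemma mode_potential_stuck (f : nat -> S) N :
  (forall i, (N <= i)%N -> f i != s) ->
  exists i, mode_potential (mode (mkseq f i)) (f i) = 0.
Proof.
move=> fs; have modeS j : mode (mkseq f (N + j).+1) =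
    next_mode (mode (mkseq f (N + j))) (f (N + j)%N).
  by rewrite mkseq_rcons mode_rcons.
have left j : (mode (mkseq f (N + j))).1.2 = ((mode (mkseq f N)).1.2 - j)%N.
  elim: j => [|j IH]; first by rewrite addn0 subn0.
  rewrite addnS modeS subnS -IH; case: (mode (mkseq f (N + j))) => -[k m] d /=.
  by rewrite (negbTE (fs _ (leq_addr _ _))).
set i := (N + (mode (mkseq f N)).1.2)%N; exists i.
have := left (mode (mkseq f N)).1.2; rewrite subnn -/i.
have fi : f i != s by apply: fs; exact: leq_addr.
case: (mode (mkseq f i)) => -[k m] d /= ->; rewrite /= (negbTE fi).
by rewrite mul0r subr0 sub0r; apply/max_idPl; rewrite oppr_le0 exprn_ge0// invr_ge0.
Qed.

(** Runs along which the potential stays positive visit [s] infinitely often. Started in [s], they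
    have probability at least the initial potential, which is [1 - 2^-1]. *)
Lemma cycles_absurd : False.
Proof.
have law_act rho x : act M x (mode_law (mode rho) x).
  by case: (mode rho) => -[k m] d /=; case: eqP => [->|_].
have [sigma [_ step_law]] := strategy_ex law_act.
pose W rho x := mode_potential (mode rho) x.
have W01 rho x : 0 <= W rho x <= 1.
  by apply: mode_potential_bounds; exact: mode_loss_gt0.
have Wstep rho x : W rho x <= Ex (step sigma rho x) (W (rcons rho x)).
  rewrite step_law /W mode_rcons; apply: mode_potential_step.
  exact: mode_loss_gt0.
pose G rho x : Prop := 0 < W rho x.
have Wgood rho x : 0 < W rho x -> G rho x by [].
have P_law := @run_lawP R S M s sigma.
have := potential_good P_law W01 Wgood Wstep; set A := good_forever _ => PA.
have mT : measurable (Transience M : set (seqSpace s)).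
  exact: measurable_Transience.
have : (run_law M s sigma A <= run_law M s sigma (~` Transience M))%E.
  apply: le_measure; rewrite ?inE.
  - exact: measurable_good_forever.
  - exact: measurableC.
  move=> f fA [_ fT]; have [N fN] : exists N, forall i, (N <= i)%N -> f i != s.
    have [ks kE] := (finite_seqP _).1 (fT s).
    exists (\max_(k <- ks) k).+1 => i; rewrite leqNgt; apply: contraNneq => fis.
    rewrite ltnS; apply: leq_bigmax_seq => //.
    by have : [set i | f i = s] i by []; rewrite kE.
  have [i Wi] := mode_potential_stuck fN.
  by have := fA i; rewrite /G /W Wi ltxx.
rewrite probability_setC// M_transient subee// => PA0.
have := le_trans PA PA0; rewrite lee_fin /W /= eqxx mul0r subr0.
by apply/negP; rewrite -ltNge lt_max expr1; apply/orP; right; lra.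
Qed.

End cycles.

Lemma ret_lt1 s : ret M s < 1.
Proof.
rewrite ltNge; apply/negP => ret1.
have exQ k : exists p : nat * dist R S,
    act M s p.2 /\ 1 - 2^-1 ^+ (k + 3) <= Ex p.2 (hit M s p.1).
  have b0 : 0 < 2^-1 ^+ (k + 3) :> R by rewrite exprn_gt0// invr_gt0 ltr0n.
  have [_ [n [q [aq ->]]] hq] := sup_adherent b0
    (conj (ret_nonempty M s) (ret_bounded M s)).
  exists (n, q); split=> //=; apply: le_trans (ltW hq).
  by rewrite lerD2r.
have [Q HQ] := choice exQ.
have exc (p : S * nat * R) : exists q, act M p.1.1 q /\
    (p.1.1 != s -> 0 < p.2 ->
     hit M s p.1.2.+1 p.1.1 - p.2 <= Ex q (hit M s p.1.2)).
  case: p => -[x m] d /=; have [[xs d0]|no] := pselect (x != s /\ 0 < d).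
    by have [q aq /ltW ?] := hit_adherent M m xs d0; exists q.
  by have [q aq] := act_ex M x; exists q; split=> // xs d0; exfalso; apply: no.
have [c Hc] := choice exc.
apply: (@cycles_absurd s Q (fun x m d => c (x, m, d))).
- by move=> k; case: (HQ k).
- by move=> k; case: (HQ k).
- by move=> x m d; case: (Hc (x, m, d)).
- by move=> x m d; case: (Hc (x, m, d)).
Qed.

End returning.

(** * An upper bound of the safety value, with nearly optimal one-step laws *)

Section safety_value.
Context {R : realType} {S : countType} (M : mdp R S) (T : set S).

(* The conditional probabilities of [Safety T] given a history ending in [x],
   over all initial states and strategies (junk value 0 included, so that the
   supremum is over a nonempty set).  Conditioning on histories instead of
   starting in [x] avoids shifting strategies in [safe_adherent]. *)
Definition safe_values x : set R := [set u | u = 0 \/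
  exists s0 (sigma : strategy M) g m, let P := run_law M s0 sigma in
  [/\ g 0%N = s0, g m = x, P (cylinder g m.+1) != 0%E &
      (u%:E * P (cylinder g m.+1) <= P (cylinder g m.+1 `&` Safety M T))%E]].

Definition safe x : R := sup (safe_values x).

Lemma measurable_cylinder_Safety s0 g n :
  measurable (cylinder g n `&` Safety M T : set (seqSpace s0)).
Proof.
by apply: measurableI; [exact: measurable_cylinder|exact: measurable_Safety].
Qed.

Lemma cylinder_prob s0 (sigma : strategy M) g m :
  let P := run_law M s0 sigma in P (cylinder g m.+1) != 0%E ->
  exists2 p : R, 0 < p & P (cylinder g m.+1) = p%:E.
Proof.
move=> P Pg; have mg : measurable (cylinder g m.+1 : set (seqSpace s0)).
  exact: measurable_cylinder.
exists (fine (P (cylinder g m.+1))); last first.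
  by rewrite fineK// fin_num_measure.
rewrite fine_gt0// lt_neqAle eq_sym Pg measure_ge0/=.
by rewrite (le_lt_trans (probability_le1 P mg))// ltry.
Qed.

Lemma safe_values0 x : safe_values x 0.
Proof. by left. Qed.

Lemma safe_values_le1 x u : safe_values x u -> u <= 1.
Proof.
move=> [->|[s0 [sigma [g [m [g0 gm Pg Pu]]]]]]; first exact: ler01.
have [p p0 pE] := cylinder_prob Pg.
have : (u%:E * run_law M s0 sigma (cylinder g m.+1) <=
        run_law M s0 sigma (cylinder g m.+1))%E.
  apply: le_trans Pu _; apply: le_measure; rewrite ?inE.
  - exact: measurable_cylinder_Safety.
  - exact: measurable_cylinder.
  - by move=> f [].
by rewrite pE -EFinM lee_fin ger_pMl.
Qed.

Lemma safe_values_bounded x : has_ubound (safe_values x).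
Proof. by exists 1 => u; exact: safe_values_le1. Qed.

Lemma safe_ge0 x : 0 <= safe x.
Proof. by apply: ub_le_sup; [exact: safe_values_bounded|exact: safe_values0]. Qed.

Lemma safe_le1 x : safe x <= 1.
Proof.
apply: ge_sup; first by exists 0; exact: safe_values0.
by move=> u; exact: safe_values_le1.
Qed.

Lemma nnbounded_safe : nnbounded safe.
Proof. by split=> [t|]; [exact: safe_ge0|exists 1 => t; exact: safe_le1]. Qed.

Lemma safe_target x : T x -> safe x = 0.
Proof.
move=> Tx; apply/eqP; rewrite eq_le safe_ge0 andbT.
apply: ge_sup; first by exists 0; exact: safe_values0.
move=> u [->//|[s0 [sigma [g [m [g0 gm Pg]]]]]].
have [p p0 pE] := cylinder_prob Pg; rewrite pE.
rewrite [X in run_law _ _ _ X](_ : _ = set0) ?measure0.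
  by rewrite -EFinM lee_fin pmulr_lle0.
apply/seteqP; split=> // f [fg [_ /(_ m)]]; apply.
by rewrite fg// gm.
Qed.

(** If the cylinder is not null, the conditional probability of safety given it is itself one of the
    [safe_values] of [g m]. *)
Lemma cylinder_safe s0 (sigma : strategy M) g m : g 0%N = s0 ->
  (run_law M s0 sigma (cylinder g m.+1 `&` Safety M T) <=
   run_law M s0 sigma (cylinder g m.+1) * (safe (g m))%:E)%E.
Proof.
move=> g0; set P := run_law M s0 sigma.
have mgS : measurable (cylinder g m.+1 `&` Safety M T : set (seqSpace s0)).
  exact: measurable_cylinder_Safety.
have le : (P (cylinder g m.+1 `&` Safety M T) <= P (cylinder g m.+1))%E.
  by apply: le_measure; rewrite ?inE//; exact: measurable_cylinder.
have [P0|Pg] := eqVneq (P (cylinder g m.+1)) 0%E.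
  by rewrite P0 mul0e -P0.
have [p p0 pE] := cylinder_prob Pg; rewrite pE.
have finS : P (cylinder g m.+1 `&` Safety M T) \is a fin_num.
  by rewrite fin_num_measure.
rewrite -(fineK finS) -EFinM lee_fin -ler_pdivrMl//.
apply: ub_le_sup; first exact: safe_values_bounded.
right; exists s0, sigma, g, m; split=> //.
by rewrite -/P pE -EFinM mulrAC mulVf ?gt_eqF// mul1r fineK.
Qed.

(** The law is the one played after a history that nearly attains [safe x]. Splitting by the next
    state, [cylinder_safe] bounds each continuation. *)
Lemma safe_adherent x d : 0 < d -> exists2 q, act M x q & safe x - d < Ex q safe.
Proof.
move=> d0; have [|u] := @sup_adherent _ (safe_values x) _ d0.
  by split; [exists 0; exact: safe_values0|exact: safe_values_bounded].
move=> [->|[s0 [sigma [g [m [g0 gm Pg Pu]]]]]] hu.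
  (* Here the junk value 0 already exceeds [safe x - d], so any law will do. *)
  have [q aq] := act_ex M x; exists q => //; apply: lt_le_trans hu _.
  exact: Ex_ge0 nnbounded_safe.
exists (step sigma (mkseq g m) x); first exact: act_step.
apply: lt_le_trans hu _; have [p p0 pE] := cylinder_prob Pg.
have P_law := @run_lawP R S M s0 sigma.
have mgS := @measurable_cylinder_Safety s0 g m.+1.
move: Pu; rewrite (prob_coord_esum _ m.+1 mgS).
move=> /le_trans H; rewrite -lee_fin -(@lee_pmul2l _ p%:E) ?lte_fin//.
rewrite muleC -pE; apply: H; rewrite pE ExE; last exact: nnbounded_safe.
rewrite -esumZl ?(ltW p0)// => [|t]; last first.
  by rewrite lee_fin mulr_ge0 ?dist_ge0 ?safe_ge0.
apply: le_esum => t _; rewrite setIAC cylinder_extend.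
apply: le_trans (cylinder_safe _ _ _) _; first by rewrite /extend.
have -> : extend g m t m.+1 = t by rewrite /extend ltnn.
by rewrite (prob_extend P_law)// pE gm -!EFinM mulrA.
Qed.

Lemma value_le_safe s : (value M (Safety M T) s <= (safe s)%:E)%E.
Proof.
apply: ge_ereal_sup => _ [sigma _ <-].
have P_law := @run_lawP R S M s sigma.
have := @cylinder_safe s sigma (fun=> s) 0 erefl.
rewrite (prob_start P_law) mul1e; apply: le_trans.
have mC : measurable (cylinder (fun=> s) 1 : set (seqSpace s)).
  exact: measurable_cylinder.
have mS := @measurable_cylinder_Safety s (fun=> s) 1.
(* Sequences that do not start in [s] form a null set, which is added to the right side. *)
rewrite -[leRHS]adde0.
have <- : run_law M s sigma (~` cylinder (fun=> s) 1) = 0%E.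
  by rewrite probability_setC// (prob_start P_law) subee.
apply: le_trans (measureU2 _ mS (measurableC mC)).
apply: le_measure; rewrite ?inE.
- exact: measurable_Safety.
- by apply: measurableU => //; exact: measurableC.
move=> f fS; have [fs|fs] := pselect (cylinder (fun=> s) 1 f); first by left.
by right.
Qed.

End safety_value.

(** * The expected total cost of near-optimal choices *)

Section loss.
Context {R : realType} {S : countType} (M : mdp R S).
Hypothesis M_transient : universally_transient M.
Variables (eps : R) (eps_gt0 : 0 < eps).

Definition weight (s : S) : R := eps / (2 ^ (pickle s).+1)%:R.

Lemma weight_gt0 s : 0 < weight s.
Proof. by rewrite divr_gt0// ltr0n expn_gt0. Qed.

(** A geometric series in the codes of states; [pickle] need not be onto, hence only an
    inequality. *)
Lemma weight_sum : (\esum_(s in [set: S]) (weight s)%:E <= eps%:E)%E.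
Proof.
rewrite esum_pickle => [|s]; last by rewrite lee_fin ltW// weight_gt0.
apply: le_trans (epsilon_trick0 xpredT (ltW eps_gt0)).
apply: lee_nneseries => n _ //.
  by case: pickle_inv => //= s; rewrite lee_fin ltW// weight_gt0.
case E: (pickle_inv n : option S) => [s|] /=; last first.
  by rewrite lee_fin divr_ge0// ltW.
by have := @pickle_invK S n; rewrite E /= /weight => ->.
Qed.

Definition loss x : R := fine (\esum_(s in [set: S]) (weight s * hitp M s x)%:E)%E.

Lemma loss_sum_le x :
  (\esum_(s in [set: S]) (weight s * hitp M s x)%:E <= eps%:E)%E.
Proof.
apply: le_trans weight_sum; apply: le_esum => s _.
by rewrite lee_fin ler_piMr ?hitp_le1// ltW// weight_gt0.
Qed.

Lemma weight_hitp_ge0 s x : 0 <= weight s * hitp M s x.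
Proof. by rewrite mulr_ge0 ?hitp_ge0// ltW// weight_gt0. Qed.

Lemma lossE x : (loss x)%:E = (\esum_(s in [set: S]) (weight s * hitp M s x)%:E)%E.
Proof.
rewrite /loss fineK// ge0_fin_numE; last first.
  by apply: esum_ge0 => s _; rewrite lee_fin weight_hitp_ge0.
by rewrite (le_lt_trans (loss_sum_le x))// ltry.
Qed.

Lemma loss_ge0 x : 0 <= loss x.
Proof.
by rewrite -lee_fin lossE; apply: esum_ge0 => s _; rewrite lee_fin weight_hitp_ge0.
Qed.

Lemma loss_le x : loss x <= eps.
Proof. by rewrite -lee_fin lossE loss_sum_le. Qed.

Lemma nnbounded_loss : nnbounded loss.
Proof. by split=> [t|]; [exact: loss_ge0|exists eps => t; exact: loss_le]. Qed.

(** For [s != x] the function [hitp M s] is superharmonic at [x]; for [s = x] its mean drops from 1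
    to at most [ret M x]. *)
Lemma loss_step x q : act M x q ->
  Ex q loss + weight x * (1 - ret M x) <= loss x.
Proof.
move=> aq; have w0 s : 0 <= weight s by rewrite ltW// weight_gt0.
have r1 s : 0 <= 1 - ret M s by rewrite subr_ge0 ltW// ret_lt1.
rewrite -lee_fin EFinD (lossE x).
rewrite (Ex_esum q w0 (nnbounded_hitp M) nnbounded_loss lossE).
(* The charge at [x] is written as a sum over all states, so that the comparison becomes
   termwise. *)
apply: (@le_trans _ _ (\esum_(s in [set: S]) (weight s * Ex q (hitp M s))%:E +
    \esum_(s in [set: S]) (weight s * ((s == x)%:R * (1 - ret M s)))%:E)%E).
  apply: leeD2l; apply: esum_ge; exists [set x]; first by split.
  by rewrite fsbig_set1 eqxx mul1r.
rewrite -esumD => [|s _|s _]; last 2 first.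
- by rewrite lee_fin mulr_ge0// Ex_ge0//; exact: nnbounded_hitp.
- by rewrite lee_fin mulr_ge0// mulr_ge0// ler0n.
apply: le_esum => s _; rewrite -EFinD lee_fin -mulrDr ler_wpM2l//.
have [->|sx] := eqVneq s x.
  by rewrite mul1r hitp_self addrA lerBlDr addrC lerD2l Ex_hitp_ret.
by rewrite mul0r addr0 hitp_superharmonic// eq_sym.
Qed.

End loss.

(** * Choice of the MD strategy and its safety bound *)

Unset Implicit Arguments.
Set Strict Implicit.
Set Printing Implicit Defensive.

Theorem theorem9 (R : realType) (S : countType) (M : mdp R S) (T : set S)
    (eps : R) (eps_gt0 : 0 < eps)
    (M_transient : universally_transient M) :
  exists sigma : strategy M, MD sigma /\
    forall s : S,
      (value M (Safety M T) s - eps%:E <= run_law M s sigma (Safety M T))%E.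
Proof.
pose v := safe M T; pose L := loss M eps.
pose d x := weight eps x * (1 - ret M x).
have d_gt0 x : 0 < d x by rewrite mulr_gt0 ?weight_gt0// subr_gt0 ret_lt1.
have bv : nnbounded v := nnbounded_safe M T.
have bL : nnbounded L := nnbounded_loss M eps_gt0.
have exF x : exists t, ctrl M x -> trans M x t /\ v x - d x <= v t.
  have [q aq vq] := safe_adherent M T x (d_gt0 x).
  (* A negative threshold is met by every successor, as [v] is nonnegative; otherwise [Ex_gt_ex]
     picks one. *)
  have [neg|pos] := ltP (v x - d x) 0.
    have [t xt] := trans_total M x; exists t => _; split=> //.
    by rewrite (le_trans (ltW neg))// safe_ge0.
  have [t qt vt] := Ex_gt_ex bv pos vq; exists t => _; split; last exact: ltW.
  exact: act_trans aq qt.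
have [F HF] := choice exF.
pose c (rho : seq S) x := if ctrl M x then dirac_dist R (F x) else prob M x.
have c_act rho x : act M x (c rho x).
  rewrite /c; case: (boolP (ctrl M x)) => [xc|xr].
    by apply: act_dirac => //; case: (HF x xc).
  by rewrite /act (negbTE xr).
have c_safe rho x : v x - d x <= Ex (c rho x) v.
  rewrite /c; case: (boolP (ctrl M x)) => [xc|xr].
    by rewrite Ex_dirac//; case: (HF x xc).
  have [q] := safe_adherent M T x (d_gt0 x).
  by rewrite /act (negbTE xr) => -> /ltW.
have [sigma [sigmaE stepE]] := strategy_ex c_act.
exists sigma; split.
  by exists F => rho s t sc; rewrite sigmaE /c sc.
(* [Safety] also requires the sequence to be a run, so [G] records that the last move was a
   transition. *)
move=> s; pose G (rho : seq S) x :=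
  ~ T x /\ forall h y, rho = rcons h y -> trans M y x.
pose W rho x := if `[< G rho x >] then Num.max 0 (v x - L x) else 0.
have W01 rho x : 0 <= W rho x <= 1.
  rewrite /W; case: asboolP => _; last by rewrite lexx ler01.
  rewrite le_max lexx ge_max ler01/= lerBlDr.
  by rewrite (le_trans (safe_le1 M T x))// lerDl loss_ge0.
have Wgood rho x : 0 < W rho x -> G rho x.
  by rewrite /W; case: asboolP => //; rewrite ltxx.
have bW rho : nnbounded (W rho).
  by split=> [t|]; [|exists 1 => t]; case/andP: (W01 rho t).
have Wstep rho x : W rho x <= Ex (step sigma rho x) (W (rcons rho x)).
  rewrite {1}/W; case: asboolP => _; last exact: Ex_ge0.
  rewrite ge_max Ex_ge0//= stepE.
  have vWL : Ex (c rho x) v <= Ex (c rho x) (W (rcons rho x)) + Ex (c rho x) L.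
    rewrite -ExD//; apply: Ex_le => //; first exact: nnboundedD.
    move=> t ct /=; have W0 : 0 <= W (rcons rho x) t by case/andP: (W01 (rcons rho x) t).
    (* On [T] the value [v] is 0, so cutting [W] to 0 there costs nothing; off [T], a state of
       positive probability is a successor, so [G] holds. *)
    have [Tt|nTt] := pselect (T t).
      by rewrite /v safe_target// addr_ge0// loss_ge0.
    rewrite -lerBlDr /W asboolT ?le_max ?lexx ?orbT//.
    split=> // h y /rcons_inj [_ <-]; exact: act_trans (c_act rho x) ct.
  (* The mean of [v] falls by at most [d x], and that of [L] falls by at least [d x]. *)
  have := loss_step M_transient eps_gt0 (c_act rho x); rewrite -/L -/(d x).
  have := c_safe rho x; lra.
have P_law := @run_lawP R S M s sigma.
apply: (@le_trans _ _ (v s - eps)%:E).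
  by rewrite EFinB leeB// value_le_safe.
apply: (@le_trans _ _ (W [::] s)%:E).
  rewrite lee_fin; have [Ts|nTs] := pselect (T s).
    rewrite /v safe_target// sub0r (@le_trans _ _ 0)//; last by case/andP: (W01 [::] s).
    by rewrite oppr_le0 ltW.
  rewrite /W asboolT; last by split=> // -[].
  rewrite le_max; apply/orP; right; rewrite lerB//; exact: loss_le.
apply: le_trans (potential_good P_law W01 Wgood Wstep) _.
apply: le_measure; rewrite ?inE.
- exact: measurable_good_forever.
- exact: measurable_Safety.
move=> f fG; split=> i; last by case: (fG i).
(* The transition out of [f i] is recorded by [G] one step later. *)
by case: (fG i.+1) => _; apply; rewrite mkseq_rcons.
Qed.
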